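(* Let $T$, $O$, $C$, $D$, $I$ denote the graphs ($1$-skeletons) of the tetrahedron, octahedron, cube, dodecahedron, and icosahedron, respectively. Then (a) $\operatorname{arc}(T) \le 3$; (b) $\operatorname{arc}(O) \le 3$; (c) $\operatorname{arc}(C) \le 4$; (d) $\operatorname{arc}(D) \le 10$; (e) $\operatorname{arc}(I) \le 7$.
   Context: A circular-arc drawing of a planar graph $G$ represents the vertices by distinct points of $\mathbb{R}^2$ and each edge by a circular arc connecting the points of its endvertices; drawings are required to be crossing-free, i.e., no edge passes through a vertex other than its endpoints and any two edges are disjoint except possibly at common endpoints. The arc number $\operatorname{arc}(G)$ of a planar graph $G$ is the minimum, over all crossing-free circular-arc drawings of $G$ in the plane, of the number of circular arcs whose union is the drawing; here a single arc may consist of several consecutive edges lying on the same circle, and a full circle counts as one arc. *)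

(* Defs.v *)
From HB Require Import structures.
From mathcomp Require Import all_boot all_order all_algebra.
From mathcomp Require Import all_classical all_reals all_analysis.

Set Implicit Arguments.
Unset Strict Implicit.
Unset Printing Implicit Defensive.

Import Order.TTheory GRing.Theory Num.Theory.
Local Open Scope classical_set_scope.
Local Open Scope ring_scope.

Record sgraph := SGraph {
  vertex :> finType;
  adj : rel vertex;
  adj_sym : symmetric adj;
  adj_irrefl : irreflexive adj }.

Section CircularArcs.
Variable R : realType.

Definition circle_point (c : R * R) (r t : R) : R * R :=
  (c.1 + r * cos t, c.2 + r * sin t).

(* A nondegenerate closed arc of a circle of positive radius, traversed
   counterclockwise from angle [arc_from] to angle [arc_to]; the value
   [arc_to = arc_from + 2 * pi] gives the full circle.  Straight segments are
   not circular arcs here. *)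
Record circular_arc := CircularArc {
  arc_center : R * R;
  arc_radius : R;
  arc_from : R;
  arc_to : R;
  arc_radius_gt0 : 0 < arc_radius;
  arc_from_lt_to : arc_from < arc_to;
  arc_to_le_turn : arc_to <= arc_from + 2 * pi }.

Definition arc_set (A : circular_arc) : set (R * R) :=
  circle_point (arc_center A) (arc_radius A) @` `[arc_from A, arc_to A].

Definition arc_source (A : circular_arc) : R * R :=
  circle_point (arc_center A) (arc_radius A) (arc_from A).

Definition arc_target (A : circular_arc) : R * R :=
  circle_point (arc_center A) (arc_radius A) (arc_to A).

Definition connects (A : circular_arc) (p q : R * R) : Prop :=
  (arc_source A = p /\ arc_target A = q) \/
  (arc_source A = q /\ arc_target A = p).

(* The values of [curve] at nonadjacent pairs are irrelevant.  The arc of an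
   edge joins two distinct points, so it is never a full circle. *)
Record crossing_free_drawing (G : sgraph) (pos : G -> R * R)
    (curve : G -> G -> circular_arc) : Prop := CrossingFreeDrawing {
  drawing_pos_inj : injective pos;
  drawing_curve_sym : forall u v : G, adj u v ->
    arc_set (curve u v) = arc_set (curve v u);
  drawing_connects : forall u v : G, adj u v ->
    connects (curve u v) (pos u) (pos v);
  drawing_vertex_free : forall u v w : G, adj u v ->
    arc_set (curve u v) (pos w) -> w = u \/ w = v;
  drawing_disjoint : forall u v x y : G, adj u v -> adj x y ->
    [set u; v]%SET != [set x; y]%SET ->
    forall p : R * R, arc_set (curve u v) p -> arc_set (curve x y) p ->
    exists2 w : G, w \in ([set u; v] :&: [set x; y])%SET & p = pos w }.

Definition drawing_set (G : sgraph) (curve : G -> G -> circular_arc) :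
    set (R * R) :=
  [set p | exists u v : G, adj u v /\ arc_set (curve u v) p].

(* The covering arcs need not be single edges, and they may meet. *)
Definition drawable_with (G : sgraph) (k : nat) : Prop :=
  exists (pos : G -> R * R) (curve : G -> G -> circular_arc),
    crossing_free_drawing pos curve /\
    exists A : 'I_k -> circular_arc,
      \bigcup_(i in [set: 'I_k]) arc_set (A i) = drawing_set curve.

(* [k] is the arc number of [G].  No such [k] exists when [G] has no
   crossing-free circular-arc drawing. *)
Definition is_arc_number (G : sgraph) (k : nat) : Prop :=
  drawable_with G k /\ forall j : nat, drawable_with G j -> (k <= j)%N.

End CircularArcs.

Section PlatonicGraphs.
Variable R : realType.

Definition dot3 (l x : 'rV[R]_3) : R := \sum_(i < 3) l 0 i * x 0 i.

(* The 1-skeleton of the convex hull of the points [P w], assumed to be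
   distinct and to be the vertices of that hull: u and v are adjacent when
   the segment joining them is a face, i.e. when some supporting half-space
   touches the points [P w] exactly at [P u] and [P v]. *)
Definition skeleton_adj (V : finType) (P : V -> 'rV[R]_3) : rel V :=
  fun u v => (u != v) &&
    `[< exists (l : 'rV[R]_3) (c : R), forall w : V,
          dot3 l (P w) <= c /\ (dot3 l (P w) = c <-> w = u \/ w = v) >].

Lemma skeleton_adj_sym (V : finType) (P : V -> 'rV[R]_3) :
  symmetric (skeleton_adj P).
Proof.
suff H u v : skeleton_adj P u v -> skeleton_adj P v u.
  by move=> u v; apply/idP/idP; apply: H.
case/andP=> nuv /asboolP[l [c Hlc]]; rewrite /skeleton_adj eq_sym nuv /=.
apply/asboolP; exists l, c => w; have [le_c eq_c] := Hlc w; split=> //.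
by rewrite eq_c; split=> -[]->; [right | left | right | left].
Qed.

Lemma skeleton_adj_irrefl (V : finType) (P : V -> 'rV[R]_3) :
  irreflexive (skeleton_adj P).
Proof. by move=> u; rewrite /skeleton_adj eqxx. Qed.

Definition skeleton (V : finType) (P : V -> 'rV[R]_3) : sgraph :=
  SGraph (skeleton_adj_sym P) (skeleton_adj_irrefl P).

Definition vec3 (x y z : R) : 'rV[R]_3 := \row_(j < 3) [:: x; y; z]`_j.

(* The three cyclic permutations of (x, y, z). *)
Definition cyc3 (i : 'I_3) (x y z : R) : 'rV[R]_3 :=
  \row_(j < 3) [:: x; y; z]`_((i + j) %% 3).

Definition sg (b : bool) : R := (-1) ^+ b.

Definition golden : R := (1 + Num.sqrt 5) / 2.

(* (a, b, ab) with a, b = +-1: alternate vertices of the cube. *)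
Definition tetrahedron : sgraph :=
  skeleton (fun v : bool * bool =>
    vec3 (sg v.1) (sg v.2) (sg v.1 * sg v.2)).

Definition octahedron : sgraph :=
  skeleton (fun v : 'I_3 * bool => cyc3 v.1 (sg v.2) 0 0).

Definition cube : sgraph :=
  skeleton (fun v : bool * bool * bool =>
    vec3 (sg v.1.1) (sg v.1.2) (sg v.2)).

(* (+-1, +-1, +-1) and the cyclic permutations of (0, +-1/golden, +-golden). *)
Definition dodecahedron : sgraph :=
  skeleton (fun v : (bool * bool * bool) + ('I_3 * bool * bool) =>
    match v with
    | inl (a, b, c) => vec3 (sg a) (sg b) (sg c)
    | inr (i, a, b) => cyc3 i 0 (sg a / golden) (sg b * golden)
    end).

Definition icosahedron : sgraph :=
  skeleton (fun v : 'I_3 * bool * bool =>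
    cyc3 v.1.1 0 (sg v.1.2) (sg v.2 * golden)).

End PlatonicGraphs.

(* Main.v *)
From Stdlib Require Import ZArith.
From HB Require Import structures.
Require Import Defs.
From mathcomp Require Import all_boot all_order all_algebra.
From mathcomp Require Import all_classical all_reals all_analysis.
From mathcomp Require Import ssrZ zify ring lra.

Set Implicit Arguments.
Unset Strict Implicit.
Unset Printing Implicit Defensive.

Import Order.TTheory GRing.Theory Num.Theory.
Local Open Scope classical_set_scope.
Local Open Scope ring_scope.

(* Each graph is drawn with integer vertices and integer centres.  On a circle,
   the points of the counterclockwise arc from s to t are those on the right of
   the chord st, so that all conditions on a drawing become signs of integers:
   two arcs of the same circle are compared through the cyclic order of their
   ends, and at the two common points of two circles the chord conditions have
   values A + B * sqrt D with A, B and D integers.  An edge of a skeleton is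
   supported by the sum of its ends; a pair (u, v) is not an edge when v - u is
   a nonnegative combination of the edges issued from u. *)

(** * Orientation and arcs of circles *)

(** Angles would make every test transcendental, so they occur only where the arcs of the
    definitions are matched with chord conditions. The cyclic order on a circle is handled
    algebraically: the circle is projected stereographically from the very point under study, which
    turns it into a linear order. Common points of two circles are irrational in general and are
    never computed: one square root per pair of circles is enough, and signs are decided by
    squaring. Radii enter only through their squares, so they may be irrational too. A vertex of odd
    degree must be an end of some covering arc that is not a full circle. This shapes the covers of
    the cube, the dodecahedron and the icosahedron, in which every vertex ends exactly one open arc.
    Adjacency in a skeleton is an existential over all half-spaces, so that edges and non-edges
    alike need a certificate that can be computed. *)

Definition orient (T : pzRingType) (a b p : T * T) : T :=
  (b.1 - a.1) * (p.2 - a.2) - (b.2 - a.2) * (p.1 - a.1).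

Definition sqdist (T : pzRingType) (p c : T * T) : T :=
  (p.1 - c.1) ^+ 2 + (p.2 - c.2) ^+ 2.

Section OrientationOnCircle.
Variable F : realFieldType.
Implicit Types (a b c p q s t : F * F) (k : F).

Lemma orient_cycl a b p : orient a b p = orient b p a.
Proof. by rewrite /orient; ring. Qed.

Lemma orient_swap a b p : orient b a p = - orient a b p.
Proof. by rewrite /orient; ring. Qed.

Lemma sqdist_eq0 p q : sqdist p q = 0 -> p = q.
Proof.
case: p q => [p1 p2] [q1 q2] /eqP /=.
rewrite paddr_eq0 ?sqr_ge0//= !sqrf_eq0 !subr_eq0 => /andP[/eqP /= -> /eqP /= ->].
by [].
Qed.

(* Inverse stereographic projection, from the point p, of the circle with
   centre c through p. *)
Definition circle_at c p k : F * F :=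
  (p.1 + 2 * ((c.1 - p.1) - k * (c.2 - p.2)) / (1 + k ^+ 2),
   p.2 + 2 * ((c.2 - p.2) + k * (c.1 - p.1)) / (1 + k ^+ 2)).

(** With [w = c - p] and [q = a - p], lying on the circle means that twice the dot product of [w]
    and [q] is the squared length of [q]. The parameter [k] is the tangent of the angle from [w] to
    [q], cross product over dot product, and the denominator vanishes only for [a = p]. *)
Lemma circle_atP c p a : sqdist a c = sqdist p c -> a <> p ->
  exists k, a = circle_at c p k.
Proof.
case: a p c => [a1 a2] [p1 p2] [c1 c2]; rewrite /sqdist /circle_at /= => e ne.
have d0 : (a1 - p1) ^+ 2 + (a2 - p2) ^+ 2 != 0.
  by apply/eqP => d; apply: ne; apply: sqdist_eq0.
set X := a1 - p1 in d0; set Y := a2 - p2 in d0; set u := c1 - p1; set v := c2 - p2.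
have e' : 2 * (u * X + v * Y) = X ^+ 2 + Y ^+ 2.
  by rewrite /u /v /X /Y; lra.
have d1 : u * X + v * Y != 0.
  by apply/eqP => d; move: d0; rewrite -e' d mulr0 eqxx.
pose k := (u * Y - v * X) / (u * X + v * Y); exists k.
have kE : k * (u * X + v * Y) = u * Y - v * X by rewrite /k divfK.
have k1 : 1 + k ^+ 2 != 0 by rewrite gt_eqF// ltr_pwDl// sqr_ge0.
have e2 : (u * X + v * Y) ^+ 2 + (u * Y - v * X) ^+ 2 =
    (u ^+ 2 + v ^+ 2) * (2 * (u * X + v * Y)) by rewrite e'; ring.
have eX : X * (1 + k ^+ 2) = 2 * (u - k * v).
  apply: (mulfI d1); apply: (mulfI d1).
  transitivity (X * ((u * X + v * Y) ^+ 2 + (k * (u * X + v * Y)) ^+ 2)).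
    by ring.
  rewrite kE e2; transitivity (2 * (u * X + v * Y) *
    (u * (u * X + v * Y) - v * (k * (u * X + v * Y)))); last by ring.
  by rewrite kE; ring.
have eY : Y * (1 + k ^+ 2) = 2 * (v + k * u).
  apply: (mulfI d1); apply: (mulfI d1).
  transitivity (Y * ((u * X + v * Y) ^+ 2 + (k * (u * X + v * Y)) ^+ 2)).
    by ring.
  rewrite kE e2; transitivity (2 * (u * X + v * Y) *
    (v * (u * X + v * Y) + u * (k * (u * X + v * Y)))); last by ring.
  by rewrite kE; ring.
congr pair.
  by rewrite -eX mulfK// /X; ring.
by rewrite -eY mulfK// /Y; ring.
Qed.

(** Orientation becomes a Vandermonde product: [k] increases counterclockwise along the circle cut
    at [p], so the cyclic order of three points is the linear order of their parameters up to
    rotation. *)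
Lemma orient_circle_at c p ka kb kg :
  orient (circle_at c p ka) (circle_at c p kb) (circle_at c p kg) *
    ((1 + ka ^+ 2) * (1 + kb ^+ 2) * (1 + kg ^+ 2)) =
  4 * sqdist p c * ((kb - ka) * (kg - kb) * (kg - ka)).
Proof.
have nz k : 1 + k ^+ 2 != 0 by rewrite gt_eqF// ltr_pwDl// sqr_ge0.
by rewrite /orient /circle_at /sqdist /=; field; rewrite !nz.
Qed.

Lemma orient_base_circle_at c p ka kb :
  orient p (circle_at c p ka) (circle_at c p kb) *
    ((1 + ka ^+ 2) * (1 + kb ^+ 2)) = 4 * sqdist p c * (kb - ka).
Proof.
have nz k : 1 + k ^+ 2 != 0 by rewrite gt_eqF// ltr_pwDl// sqr_ge0.
by rewrite /orient /circle_at /sqdist /=; field; rewrite !nz.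
Qed.
End OrientationOnCircle.

Section ArcsOnCircle.
Variable F : realFieldType.
Implicit Types (a b c g p s t : F * F).

Lemma sqdist_gt0 p c s : sqdist s c = sqdist p c -> s <> p -> 0 < sqdist p c.
Proof.
move=> e ne; rewrite lt_neqAle addr_ge0 ?sqr_ge0// andbT eq_sym.
apply/eqP => z; apply: ne.
by rewrite (sqdist_eq0 z) (@sqdist_eq0 _ s c)// e.
Qed.

Lemma orient_base_le0 c p ka kb : 0 < sqdist p c ->
  (orient p (circle_at c p ka) (circle_at c p kb) <= 0) = (kb <= ka).
Proof.
move=> r0; rewrite -(pmulr_lle0 _ (_ : 0 < (1 + ka ^+ 2) * (1 + kb ^+ 2))).
  by rewrite orient_base_circle_at pmulr_rle0 ?subr_le0// mulr_gt0.
by rewrite mulr_gt0// ltr_pwDl// sqr_ge0.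
Qed.

Lemma orient_circle_ge0 c p ka kb kg : 0 < sqdist p c ->
  (0 <= orient (circle_at c p ka) (circle_at c p kb) (circle_at c p kg)) =
  (0 <= (kb - ka) * (kg - kb) * (kg - ka)).
Proof.
move=> r0; rewrite -(pmulr_lge0 _
    (_ : 0 < (1 + ka ^+ 2) * (1 + kb ^+ 2) * (1 + kg ^+ 2))).
  by rewrite orient_circle_at pmulr_rge0// mulr_gt0.
by rewrite !mulr_gt0// ltr_pwDl// sqr_ge0.
Qed.

Lemma orient_eq0_on_circle c s t p : sqdist s c = sqdist p c ->
  sqdist t c = sqdist p c -> s <> t -> orient s t p = 0 -> p = s \/ p = t.
Proof.
move=> sc tc st o.
have [->|/eqP ps] := eqVneq p s; first by left.
have [->|/eqP pt] := eqVneq p t; first by right.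
have r0 : 0 < sqdist p c by apply: (sqdist_gt0 sc); exact: nesym.
have [ks es] := circle_atP sc (nesym ps).
have [kt et] := circle_atP tc (nesym pt).
case: st; rewrite es et; congr circle_at; apply/eqP; rewrite eq_le.
rewrite -(orient_base_le0 kt ks r0) -(orient_base_le0 ks kt r0) -es -et.
by rewrite (orient_cycl p t) (orient_cycl p s) orient_swap o oppr0 lexx.
Qed.

Lemma cyclic_between (k l m : F) : l < k ->
  0 <= (l - k) * (m - l) * (m - k) -> l <= m <= k.
Proof.
move=> lk; rewrite -mulrA nmulr_rge0 ?subr_lt0// => h.
apply/andP; split; rewrite leNgt; apply/negP => mk; move: h; apply/negP;
  rewrite -ltNge.
  by rewrite nmulr_rgt0 subr_lt0// (lt_trans mk).
by rewrite mulr_gt0 ?subr_gt0// (lt_trans lk).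
Qed.

(** Concatenation of arcs. Seen from [p], lying on the arc from [x] to [y] means that the parameter
    of [y] is at most that of [x], and the statement concerns the order of three numbers. The cases
    where [p] is one of the three points come first, since the projection from [p] misses them. *)
Lemma arc_split c a b g p : sqdist a c = sqdist p c -> sqdist b c = sqdist p c ->
  sqdist g c = sqdist p c -> 0 < orient a b g ->
  orient a g p <= 0 <-> orient a b p <= 0 \/ orient b g p <= 0.
Proof.
move=> ac bc gc o.
have [->|/eqP pa] := eqVneq p a.
  by split=> _; [left|]; rewrite /orient; lra.
have [->|/eqP pg] := eqVneq p g.
  by split=> _; [right|]; rewrite /orient; lra.
have [pb|/eqP pb] := eqVneq p b.
  have -> : orient a g p = - orient a b g by rewrite pb /orient; ring.
  split=> _; last by rewrite oppr_le0 ltW.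
  by left; rewrite pb /orient; lra.
have r0 : 0 < sqdist p c by apply: (sqdist_gt0 ac); exact: nesym.
have [ka ea] := circle_atP ac (nesym pa).
have [kb eb] := circle_atP bc (nesym pb).
have [kg eg] := circle_atP gc (nesym pg).
have := o; rewrite ltNge -oppr_ge0 -orient_swap ea eb eg orient_circle_ge0//.
rewrite -(orient_cycl p) -(orient_cycl p) -(orient_cycl p) !orient_base_le0//.
rewrite -ltNge => v; split.
  by case: (lerP kb ka) => h1 h2; [left | right; lra].
move=> h; rewrite leNgt; apply/negP => ag; move: v; apply/negP; rewrite -leNgt.
case: h => h.
  by rewrite !mulr_ge0 ?subr_ge0 ?(ltW ag)// (le_trans h) ?ltW.
rewrite -mulrA mulr_le0// ?subr_le0; first exact: le_trans (ltW ag) h.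
by rewrite mulr_ge0_le0 ?subr_ge0 ?subr_le0 ?(ltW ag).
Qed.

(** Neither arc has an end of the other in its interior. If [p] is none of the four ends, projecting
    from it turns the complement of each arc into an interval; each interval contains the ends of
    the other, so the two coincide, against the assumption that the arcs differ. *)
Lemma arcs_of_circle_meet c s t s' t' p :
  sqdist s c = sqdist p c -> sqdist t c = sqdist p c ->
  sqdist s' c = sqdist p c -> sqdist t' c = sqdist p c ->
  s <> t -> s' <> t' -> (s, t) <> (s', t') ->
  0 <= orient s t s' -> 0 <= orient s t t' ->
  0 <= orient s' t' s -> 0 <= orient s' t' t ->
  orient s t p <= 0 -> orient s' t' p <= 0 ->
  (p = s \/ p = t) /\ (p = s' \/ p = t').
Proof.
move=> sc tc sc' tc' st st' ne o1 o2 o3 o4 o5 o6.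
have end' u : sqdist u c = sqdist p c -> 0 <= orient s' t' u -> u = p ->
    p = s' \/ p = t'.
  move=> uc ou up; apply: (@orient_eq0_on_circle c) => //.
  by apply/eqP; rewrite eq_le o6 -up ou.
have end_ u : sqdist u c = sqdist p c -> 0 <= orient s t u -> u = p ->
    p = s \/ p = t.
  move=> uc ou up; apply: (@orient_eq0_on_circle c) => //.
  by apply/eqP; rewrite eq_le o5 -up ou.
have [ps|/eqP ps] := eqVneq p s.
  by split; [left | apply: (end' s)].
have [pt|/eqP pt] := eqVneq p t.
  by split; [right | apply: (end' t)].
have [ps'|/eqP ps'] := eqVneq p s'.
  by split; [apply: (end_ s') | left].
have [pt'|/eqP pt'] := eqVneq p t'.
  by split; [apply: (end_ t') | right].
have r0 : 0 < sqdist p c by apply: (sqdist_gt0 sc); exact: nesym.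
have [ks es] := circle_atP sc (nesym ps).
have [kt et] := circle_atP tc (nesym pt).
have [ks' es'] := circle_atP sc' (nesym ps').
have [kt' et'] := circle_atP tc' (nesym pt').
have lt_t : kt < ks.
  rewrite lt_neqAle; apply/andP; split.
    by apply/eqP => k; apply: st; rewrite es et k.
  by move: o5; rewrite -orient_cycl es et orient_base_le0.
have lt_t' : kt' < ks'.
  rewrite lt_neqAle; apply/andP; split.
    by apply/eqP => k; apply: st'; rewrite es' et' k.
  by move: o6; rewrite -orient_cycl es' et' orient_base_le0.
case: ne.
move: o1 o2 o3 o4; rewrite es et es' et' !orient_circle_ge0// => o1 o2 o3 o4.
have [/andP[? ?] /andP[? ?] /andP[? ?] /andP[? ?]] := And4
  (cyclic_between lt_t o1) (cyclic_between lt_t o2)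
  (cyclic_between lt_t' o3) (cyclic_between lt_t' o4).
by congr (circle_at _ _ _, circle_at _ _ _); apply/eqP; rewrite eq_le; apply/andP.
Qed.
End ArcsOnCircle.

(* Sufficient for A + B * sqrt D > 0, when D >= 0. *)
Definition pos_surd (T : numDomainType) (A B D : T) : bool :=
  if 0 <= A then
    if 0 <= B then (0 < A) || (0 < B) && (0 < D) else B ^+ 2 * D < A ^+ 2
  else (0 < B) && (A ^+ 2 < B ^+ 2 * D).

Lemma pos_surdP (F : realFieldType) (A B D h : F) :
  pos_surd A B D -> 0 <= h -> h ^+ 2 = D -> 0 < A + B * h.
Proof.
move=> + h0 hD; rewrite /pos_surd -hD -exprMn.
have [A0|A0] := lerP 0 A; last first.
  move=> /andP[B0]; rewrite -[A ^+ 2]sqrrN ltr_sqr ?nnegrE ?oppr_ge0 ?(ltW A0)//.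
    by rewrite -subr_gt0 opprK addrC.
  by rewrite mulr_ge0// ltW.
have [B0|B0] := lerP 0 B; last first.
  rewrite -[(B * h) ^+ 2]sqrrN ltr_sqr ?nnegrE//.
    by rewrite -subr_gt0 opprK.
  by rewrite oppr_ge0 mulr_le0_ge0// ltW.
case/orP => [A1|/andP[B1 h1]]; first by rewrite ltr_pwDl// mulr_ge0.
rewrite ltr_wpDl// mulr_gt0// lt_neqAle h0 andbT eq_sym.
by apply: contraTneq h1 => ->; rewrite expr0n ltxx.
Qed.

(* The points of the circles of squared radii r and r' about c and d are the
   c + (radical_offset * w + h * J w) / (2 * |w|^2), with w = d - c, J the
   rotation by a right angle and h ^+ 2 = radical_disc.  An h <= 0 is treated
   as an h >= 0 after changing the sign of its coefficients: [sgn] is the sign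
   of h. *)
Definition radical_offset (T : pzRingType) (c d : T * T) (r r' : T) : T :=
  sqdist d c + r - r'.

Definition radical_disc (T : pzRingType) (c d : T * T) (r r' : T) : T :=
  4 * sqdist d c * r - radical_offset c d r r' ^+ 2.

(** At such a common point, [orient s t] times [2 * sqdist d c] is affine in [h]: the first argument
    of [pos_surd] is its constant term, the second its slope with the sign of [h] moved into it. *)
Definition outside_arc (T : numDomainType) (c d : T * T) (r r' sgn : T)
    (s t : T * T) : bool :=
  let w := (d.1 - c.1, d.2 - c.2) in
  pos_surd (2 * sqdist d c * orient s t c +
            radical_offset c d r r' * ((t.1 - s.1) * w.2 - (t.2 - s.2) * w.1))
    (sgn * ((t.1 - s.1) * w.1 + (t.2 - s.2) * w.2)) (radical_disc c d r r').

Section TwoCircles.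
Variables (F : realFieldType) (c d : F * F) (r r' : F).
Implicit Types (p q s t : F * F).

Let h p := 2 * orient c d p.

Lemma radical_discP p : sqdist p c = r -> sqdist p d = r' ->
  h p ^+ 2 = radical_disc c d r r'.
Proof.
by move=> <- <-; rewrite /h /radical_disc /radical_offset /orient /sqdist; ring.
Qed.

Lemma radical_disc_ge0 p : sqdist p c = r -> sqdist p d = r' ->
  0 <= radical_disc c d r r'.
Proof. by move=> pr pr'; rewrite -(radical_discP pr pr') sqr_ge0. Qed.

(** The two common points are mirror images in the line of centres, so the side determines the
    point: [p - q] is orthogonal to that line because both points lie on the radical axis, and
    parallel to it because their distances to the line agree. *)
Lemma circles_point_eq p q : c <> d -> sqdist p c = r -> sqdist p d = r' ->
  sqdist q c = r -> sqdist q d = r' -> 0 <= orient c d p * orient c d q -> p = q.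
Proof.
move=> cd pr pr' qr qr' pq.
have N0 : sqdist d c != 0.
  by apply/eqP => z; apply: cd; rewrite (sqdist_eq0 z).
have hpq : orient c d p = orient c d q.
  have : h p ^+ 2 = h q ^+ 2 by rewrite !radical_discP.
  rewrite /h !exprMn => /mulfI; rewrite expf_neq0 ?pnatr_eq0// => /(_ isT)/eqP.
  rewrite eqf_sqr => /orP[/eqP//|/eqP e].
  move: pq; rewrite e mulNr oppr_ge0 -expr2 => q0.
  have /eqP : orient c d q ^+ 2 = 0 by apply/eqP; rewrite eq_le q0 sqr_ge0.
  by rewrite sqrf_eq0 => /eqP ->; rewrite oppr0.
have dot : (d.1 - c.1) * (p.1 - q.1) + (d.2 - c.2) * (p.2 - q.2) = 0.
  apply: (@mulfI _ (2 : F)); first by rewrite pnatr_eq0.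
  transitivity ((sqdist p c - sqdist p d) - (sqdist q c - sqdist q d)).
    by rewrite /sqdist; ring.
  by rewrite pr pr' qr qr' subrr mulr0.
have cross : (d.1 - c.1) * (p.2 - q.2) - (d.2 - c.2) * (p.1 - q.1) = 0.
  transitivity (orient c d p - orient c d q); first by rewrite /orient; ring.
  by rewrite hpq subrr.
apply: sqdist_eq0; apply: (mulfI N0); rewrite mulr0.
transitivity (((d.1 - c.1) * (p.1 - q.1) + (d.2 - c.2) * (p.2 - q.2)) ^+ 2 +
  ((d.1 - c.1) * (p.2 - q.2) - (d.2 - c.2) * (p.1 - q.1)) ^+ 2).
  by rewrite /sqdist; ring.
by rewrite dot cross; ring.
Qed.

Lemma outside_arcP p s t sgn : c <> d -> sqdist p c = r -> sqdist p d = r' ->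
  sgn ^+ 2 = 1 -> 0 <= sgn * orient c d p -> outside_arc c d r r' sgn s t ->
  0 < orient s t p.
Proof.
move=> cd pr pr' sgn2 sp out.
have N0 : 0 < sqdist d c.
  rewrite lt_neqAle addr_ge0 ?sqr_ge0// andbT eq_sym.
  by apply/eqP => z; apply: cd; rewrite (sqdist_eq0 z).
rewrite -(pmulr_rgt0 _ (_ : 0 < 2 * sqdist d c)); last by rewrite mulr_gt0.
have h0 : 0 <= sgn * h p by rewrite /h mulrCA mulr_ge0.
have h2 : (sgn * h p) ^+ 2 = radical_disc c d r r'.
  by rewrite exprMn sgn2 mul1r radical_discP.
have := pos_surdP out h0 h2; congr (0 < _).
have -> : forall u, sgn * u * (sgn * h p) = u * h p.
  by move=> u; rewrite mulrACA -expr2 sgn2 mul1r.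
by rewrite /radical_offset -pr -pr' /h /orient /sqdist /=; ring.
Qed.
End TwoCircles.

(** * From angular arcs to chord conditions *)

Definition arc_between (R : realType) (c s t : R * R) : set (R * R) :=
  [set p | sqdist p c = sqdist s c /\ orient s t p <= 0].

Section ArcsExist.
Variable R : realType.
Implicit Types (c p s t : R * R) (r a x y : R).

Lemma unit_angle x y : x ^+ 2 + y ^+ 2 = 1 ->
  exists2 a, 0 <= a < 2 * pi & cos a = x /\ sin a = y.
Proof.
move=> xy1.
have x1 : -1 <= x <= 1.
  by rewrite -ler_norml -(@expr_le1 _ 2)// real_normK ?num_real// -xy1 lerDl sqr_ge0.
have [a0 cosa] := acos_def x1; have [a_ge0 a_lepi] := andP a0.
have sina : sin (acos x) = `|y|.
  by rewrite sin_acos// -xy1 addrC addKr sqrtr_sqr.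
have pi0 := pi_gt0 R.
have [y0|y0] := lerP 0 y.
  exists (acos x); last by rewrite cosa sina ger0_norm.
  by rewrite a_ge0; lra.
exists (2 * pi - acos x).
  suff : acos x != 0 by move=> an0; rewrite subr_ge0 ltrBlDr ltrDl lt_neqAle eq_sym an0 a_ge0 andbT; lra.
  apply: contraTneq y0 => z; rewrite -leNgt.
  by move: sina; rewrite z sin0 => /esym/eqP; rewrite normr_eq0 => /eqP ->.
rewrite mulr_natl addrC; split.
  by rewrite cosD2pi cosN cosa.
by rewrite sinD2pi sinN sina ltr0_norm// opprK.
Qed.

Lemma circle_point_dist c r a : sqdist (circle_point c r a) c = r ^+ 2.
Proof.
rewrite /sqdist /circle_point /= [_ + r * _]addrC addrK [_ + r * _]addrC addrK.
by rewrite !exprMn -mulrDr cos2Dsin2 mulr1.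
Qed.

Lemma circle_point_angle c p r a : 0 < r -> sqdist p c = r ^+ 2 ->
  exists2 b, 0 <= b < 2 * pi & p = circle_point c r (a + b).
Proof.
move=> r0 pc; have rn0 : r != 0 by rewrite gt_eqF.
pose x := (p.1 - c.1) / r; pose y := (p.2 - c.2) / r.
have xy : x ^+ 2 + y ^+ 2 = 1.
  by rewrite !expr_div_n -mulrDl -/(sqdist p c) pc divff// expf_neq0.
have [b b2 [cb sb]] : exists2 b, 0 <= b < 2 * pi &
    cos b = x * cos a + y * sin a /\ sin b = y * cos a - x * sin a.
  apply: unit_angle; transitivity ((x ^+ 2 + y ^+ 2) * (cos a ^+ 2 + sin a ^+ 2)).
    by ring.
  by rewrite xy cos2Dsin2 mulr1.
exists b => //; rewrite /circle_point cosD sinD cb sb.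
have -> : cos a * (x * cos a + y * sin a) - sin a * (y * cos a - x * sin a) =
    x * (cos a ^+ 2 + sin a ^+ 2) by ring.
have -> : sin a * (x * cos a + y * sin a) + cos a * (y * cos a - x * sin a) =
    y * (cos a ^+ 2 + sin a ^+ 2) by ring.
rewrite cos2Dsin2 !mulr1 /x /y ![r * _]mulrC !divfK// ![c.1 + _]addrC ![c.2 + _]addrC.
by rewrite !subrK; case: (p).
Qed.

Lemma circle_point_chord c r a x :
  circle_point c r (a + x) =
  ((circle_point c r a).1 -
     2 * r * sin (x / 2) * (cos a * sin (x / 2) + sin a * cos (x / 2)),
   (circle_point c r a).2 +
     2 * r * sin (x / 2) * (cos a * cos (x / 2) - sin a * sin (x / 2))).
Proof.
have hx : x = x / 2 + x / 2 by lra.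
rewrite [in LHS]hx /circle_point /= !(cosD, sinD).
have := cos2Dsin2 (x / 2); set C := cos (x / 2); set D := sin (x / 2) => h.
have {h}-> : C * C = 1 - D * D by rewrite -h; ring.
by congr pair; ring.
Qed.

(** An inscribed triangle has area [2 * r ^+ 2] times the sines of its angles, which are half the
    arcs; this is the signed version, with twice the area. *)
Lemma orient_circle_point c r a x y :
  orient (circle_point c r a) (circle_point c r (a + x)) (circle_point c r (a + y)) =
  4 * r ^+ 2 * (sin (x / 2) * sin (y / 2)) * sin ((y - x) / 2).
Proof.
have -> : (y - x) / 2 = y / 2 - x / 2 by lra.
rewrite !(circle_point_chord c r a) /orient /= sinB.
set C := cos (x / 2); set D := sin (x / 2); set E := cos (y / 2); set G := sin (y / 2).
transitivity ((cos a ^+ 2 + sin a ^+ 2) *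
    (4 * r ^+ 2 * (D * G) * (G * C - E * D))); first by ring.
by rewrite cos2Dsin2 mul1r.
Qed.

(** With angles measured from [s] within one turn, the half-angle sines at [t] and [p] are
    nonnegative, so the side of the chord is given by the sine of half the difference, that is, by
    whether [p] comes before [t]. *)
Lemma circular_arc_between c s t : s <> t -> sqdist t c = sqdist s c ->
  exists A : circular_arc R,
    [/\ arc_source A = s, arc_target A = t & arc_set A = arc_between c s t].
Proof.
move=> st tc; have r2 : 0 < sqdist s c by apply: (sqdist_gt0 tc); exact: nesym.
pose r := Num.sqrt (sqdist s c).
have r0 : 0 < r by rewrite sqrtr_gt0.
have rE : sqdist s c = r ^+ 2 by rewrite sqr_sqrtr// ltW.
have [a a2 sE] := circle_point_angle 0 r0 rE; rewrite add0r in sE.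
have [b /andP[b0 b2] tE] := circle_point_angle a r0 (etrans tc rE).
have {b0}b0 : 0 < b.
  rewrite lt_neqAle b0 andbT eq_sym; apply/eqP => bz.
  by apply: st; rewrite sE tE bz addr0.
have ab : a < a + b by rewrite ltrDl.
have ab2 : a + b <= a + 2 * pi by rewrite lerD2l ltW.
exists (CircularArc c r0 ab ab2); split => //.
have sin_half x : 0 < x < 2 * pi -> 0 < sin (x / 2).
  by move=> /andP[x0 x2]; apply: sin_gt0_pi; apply/andP; split; lra.
have sb : 0 < sin (b / 2) by rewrite sin_half// b0.
apply/seteqP; split => p; rewrite /arc_set /arc_between /=.
  move=> [x]; rewrite in_itv/= => /andP[ax xb] <-; rewrite circle_point_dist; split => //.
  have -> : x = a + (x - a) by rewrite addrC subrK.
  rewrite sE tE orient_circle_point.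
  have xa0 : 0 <= x - a by lra.
  have xab : x - a <= b by lra.
  apply: mulr_ge0_le0.
    apply: mulr_ge0; first by rewrite mulr_ge0 ?sqr_ge0.
    apply: mulr_ge0; first exact: ltW.
    by apply: sin_ge0_pi; apply/andP; split; lra.
  rewrite -oppr_ge0 -sinN; apply: sin_ge0_pi; apply/andP; split; lra.
move=> [pc o]; have [e /andP[e0 e2] pE] := circle_point_angle a r0 (etrans pc rE).
exists (a + e) => //; rewrite in_itv/= lerDl e0 lerD2l leNgt; apply/negP => be.
move: o; apply/negP; rewrite -ltNge sE tE pE orient_circle_point.
apply: mulr_gt0; last by apply: sin_half; apply/andP; split; lra.
apply: mulr_gt0; first by rewrite mulr_gt0// exprn_gt0.
by apply: mulr_gt0 => //; apply: sin_half; rewrite (lt_trans b0).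
Qed.

Lemma full_circle c r : 0 < r ->
  exists A : circular_arc R, arc_set A = [set p | sqdist p c = r ^+ 2].
Proof.
move=> r0; have pi0 := pi_gt0 R.
have t0 : (0 : R) < 2 * pi by rewrite mulr_gt0.
have t2 : 2 * pi <= (0 : R) + 2 * pi by rewrite add0r.
exists (CircularArc c r0 t0 t2); apply/seteqP; split => p; rewrite /arc_set /=.
  by move=> [x _ <-]; rewrite circle_point_dist.
move=> pc; have [b /andP[b0 b2] ->] := circle_point_angle 0 r0 pc.
by exists (0 + b) => //; rewrite in_itv/= add0r b0 ltW.
Qed.
End ArcsExist.

(** * Drawings with integer coordinates *)

Section IntegerPoints.
Variable R : realType.

(** Coordinates are binary integers because the tests are run by [vm_compute]; [zR] carries their
    outcome to the reals. *)
Definition zR (z : Z) : R := (int_of_Z z)%:~R.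

HB.instance Definition _ := GRing.RMorphism.copy zR (intmul 1 \o int_of_Z).

Lemma zRD x y : zR (x + y) = zR x + zR y.
Proof. exact: rmorphD. Qed.

Lemma zRB x y : zR (x - y) = zR x - zR y.
Proof. exact: rmorphB. Qed.

Lemma zRM x y : zR (x * y) = zR x * zR y.
Proof. exact: rmorphM. Qed.

Lemma ler_zR : {mono zR : x y / x <= y}.
Proof. by move=> x y; rewrite /zR ler_int; apply/idP/idP; lia. Qed.

Lemma ltr_zR : {mono zR : x y / x < y}.
Proof. exact: leW_mono ler_zR. Qed.

Lemma zR_inj : injective zR.
Proof. exact: inc_inj ler_zR. Qed.

Lemma zR_ge0 x : (0 <= zR x) = (0 <= x).
Proof. by rewrite -(rmorph0 zR) ler_zR. Qed.

Lemma zR_gt0 x : (0 < zR x) = (0 < x).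
Proof. by rewrite -(rmorph0 zR) ltr_zR. Qed.

Lemma pos_surd_zR A B D : pos_surd (zR A) (zR B) (zR D) = pos_surd A B D.
Proof. by rewrite /pos_surd -!rmorphXn -!rmorphM !zR_ge0 !zR_gt0 !ltr_zR. Qed.

Definition zpt (z : Z * Z) : R * R := (zR z.1, zR z.2).

Lemma zpt_inj : injective zpt.
Proof. by move=> [a b] [c d] [] /zR_inj /= -> /zR_inj /= ->. Qed.

Lemma orient_zpt a b p : orient (zpt a) (zpt b) (zpt p) = zR (orient a b p).
Proof. by rewrite /orient /= -!rmorphB -!rmorphM -rmorphB. Qed.

Lemma sqdist_zpt a b : sqdist (zpt a) (zpt b) = zR (sqdist a b).
Proof. by rewrite /sqdist /= -!rmorphB -!rmorphXn -rmorphD. Qed.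

Lemma radical_disc_zpt c d r r' :
  radical_disc (zpt c) (zpt d) (zR r) (zR r') = zR (radical_disc c d r r').
Proof.
rewrite /radical_disc /radical_offset /sqdist /=.
by rewrite !(rmorphXn, rmorphB, rmorphD, rmorphM, rmorph_nat).
Qed.

Lemma outside_arc_zpt c d r r' sgn s t :
  outside_arc (zpt c) (zpt d) (zR r) (zR r') (zR sgn) (zpt s) (zpt t) =
  outside_arc c d r r' sgn s t.
Proof.
rewrite /outside_arc radical_disc_zpt /radical_offset !sqdist_zpt orient_zpt /=.
have zR2 : zR 2%R = 2 by exact: (rmorph_nat zR).
rewrite -pos_surd_zR -zR2 -!zRB -!zRM -!zRD -!zRB.
by rewrite -!zRM -!zRD.
Qed.
End IntegerPoints.

(* A covering arc is given by its centre and by the list of the vertices met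
   along it, counterclockwise; the boolean tells that it is a full circle. *)
Definition trail := ((Z * Z) * bool * seq nat)%type.

Definition trail_center (tr : trail) := tr.1.1.
Definition trail_closed (tr : trail) := tr.1.2.
Definition trail_path (tr : trail) := tr.2.

Definition links (p : seq nat) : seq (nat * nat) := zip p (behead p).

Definition trail_links (tr : trail) : seq (nat * nat) :=
  links (if trail_closed tr
         then rcons (trail_path tr) (head 0%N (trail_path tr))
         else trail_path tr).

Definition trail_edges (tr : trail) : seq ((Z * Z) * (nat * nat)) :=
  [seq (trail_center tr, l) | l <- trail_links tr].

Definition edges (trs : seq trail) := flatten [seq trail_edges tr | tr <- trs].

Definition same_ends (k l : nat * nat) : bool :=
  (k == l) || (k == (l.2, l.1)).

Definition ends (l : nat * nat) : seq nat := [:: l.1; l.2].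

(** * Computable tests for a drawing and its cover *)

Section Checks.
Variable coords : seq (Z * Z).

Let P i := nth 0 coords i.
Let n := size coords.
Implicit Types (e f : (Z * Z) * (nat * nat)).

(** Turns are measured from the first vertex, which keeps the whole list counterclockwise within a
    single turn: the links then fill the arc from the first vertex to the last. *)
Definition trail_ok (tr : trail) : bool :=
  if trail_path tr is u :: v :: p then
    [&& all (fun w => sqdist (P w) (trail_center tr) == sqdist (P u) (trail_center tr))
          (v :: p),
        P (last v p) != P u
      & path (fun w w' => 0 < orient (P u) (P w) (P w')) v p]
  else false.

Definition edge_ok e : bool :=
  [&& (e.2.1 < n)%N, (e.2.2 < n)%N, e.2.1 != e.2.2 &
      sqdist (P e.2.2) e.1 == sqdist (P e.2.1) e.1].

Definition avoids e w : bool :=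
  [|| w \in ends e.2, sqdist (P w) e.1 != sqdist (P e.2.1) e.1
    | 0 < orient (P e.2.1) (P e.2.2) (P w)].

Definition meet_at_ends_cocircular e f : bool :=
  (sqdist (P e.2.1) e.1 != sqdist (P f.2.1) f.1) ||
  [&& 0 <= orient (P e.2.1) (P e.2.2) (P f.2.1),
      0 <= orient (P e.2.1) (P e.2.2) (P f.2.2),
      0 <= orient (P f.2.1) (P f.2.2) (P e.2.1) &
      0 <= orient (P f.2.1) (P f.2.2) (P e.2.2)].

(** On either closed side of the line of centres the circles have at most one common point; it has
    to miss one of the arcs or be a shared end lying on that side. *)
Definition meet_at_ends_beside e f (sgn : Z) : bool :=
  let r := sqdist (P e.2.1) e.1 in let r' := sqdist (P f.2.1) f.1 in
  [|| outside_arc e.1 f.1 r r' sgn (P e.2.1) (P e.2.2),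
      outside_arc e.1 f.1 r r' sgn (P f.2.1) (P f.2.2)
    | has (fun z => (z \in ends f.2) && (0 <= sgn * orient e.1 f.1 (P z)))
        (ends e.2)].

Definition meet_at_ends e f : bool :=
  if e.1 == f.1 then meet_at_ends_cocircular e f
  else (radical_disc e.1 f.1 (sqdist (P e.2.1) e.1) (sqdist (P f.2.1) f.1) < 0) ||
       (meet_at_ends_beside e f 1 && meet_at_ends_beside e f (-1)).

Definition drawing_ok (trs : seq trail) : bool :=
  [&& all trail_ok trs, all edge_ok (edges trs),
      all (fun e => all (avoids e) (iota 0 n)) (edges trs) &
      pairwise (fun e f => ~~ same_ends e.2 f.2 && meet_at_ends e f) (edges trs)].

Variable R : realType.

Let pt i := zpt R (P i).

Definition edge_arc e : set (R * R) :=
  arc_between (zpt R e.1) (pt e.2.1) (pt e.2.2).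

Hypothesis uniq_coords : uniq coords.

Lemma pt_inj i j : (i < n)%N -> (j < n)%N -> pt i = pt j -> i = j.
Proof.
by move=> ni nj /zpt_inj /eqP; rewrite nth_uniq// => /eqP.
Qed.

Lemma edge_okP e : edge_ok e -> pt e.2.1 <> pt e.2.2 /\
  sqdist (pt e.2.2) (zpt R e.1) = sqdist (pt e.2.1) (zpt R e.1).
Proof.
case/and4P => u v uv /eqP r; split; last by rewrite !sqdist_zpt r.
by move=> /pt_inj -/(_ u v) e12; rewrite e12 eqxx in uv.
Qed.

Lemma avoidsP e w : avoids e w -> edge_arc e (pt w) -> w \in ends e.2.
Proof.
case/or3P => // [/eqP ne [/= r _]|o [_ /=]].
  by case: ne; apply: (@zR_inj R); rewrite -!sqdist_zpt.
by rewrite orient_zpt leNgt zR_gt0 o.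
Qed.

Lemma meet_at_endsP e f p : edge_ok e -> edge_ok f -> ~~ same_ends e.2 f.2 ->
  meet_at_ends e f -> edge_arc e p -> edge_arc f p ->
  exists i, [/\ i \in ends e.2, i \in ends f.2 & p = pt i].
Proof.
move=> eok fok ne; have [euv er] := edge_okP eok; have [fuv fr] := edge_okP fok.
rewrite /meet_at_ends; case: eqVneq => [ef|cd].
  case/orP => [/eqP rr [/= pe _] [/= pf _]|].
    by case: rr; apply: (@zR_inj R); rewrite -!sqdist_zpt -pe -pf ef.
  case/and4P; rewrite -!(@zR_ge0 R) -!orient_zpt => o1 o2 o3 o4.
  move=> [/= pe oe] [/= pf of_]; rewrite -ef in pf fr.
  have := @arcs_of_circle_meet _ (zpt R e.1) (pt e.2.1) (pt e.2.2)
    (pt f.2.1) (pt f.2.2) p (esym pe) (etrans er (esym pe)) (esym pf)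
    (etrans fr (esym pf)) euv fuv _ o1 o2 o3 o4 oe of_.
  case/and4P: eok => ue ve _ _; case/and4P: fok => uf vf _ _.
  case=> [eq|pE pF].
    have e1 := pt_inj ue uf (congr1 fst eq); have e2 := pt_inj ve vf (congr1 snd eq).
    by case/orP: ne; left; apply/eqP; case: (e.2) (f.2) e1 e2 => ? ? [? ?] /= -> ->.
  have [i ie pi] : exists2 i, i \in ends e.2 & p = pt i.
    by case: pE => ->; [exists e.2.1 | exists e.2.2] => //; rewrite !inE eqxx ?orbT.
  have [j jf pj] : exists2 j, j \in ends f.2 & p = pt j.
    by case: pF => ->; [exists f.2.1 | exists f.2.2] => //; rewrite !inE eqxx ?orbT.
  exists i; split => //; suff -> : i = j by [].
  apply: pt_inj; last by rewrite -pi.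
    by move: ie; rewrite !inE => /orP[] /eqP ->.
  by move: jf; rewrite !inE => /orP[] /eqP ->.
have cdR : zpt R e.1 <> zpt R f.1 by move/zpt_inj; exact/eqP.
move=> meet [/= pe oe] [/= pf of_]; case/orP: meet => [D|/andP[pos neg]].
  move: (radical_disc_ge0 pe pf); rewrite !sqdist_zpt radical_disc_zpt zR_ge0.
  by rewrite leNgt D.
have beside sgn : sgn ^+ 2 = 1 -> 0 <= zR R sgn * orient (zpt R e.1) (zpt R f.1) p ->
    meet_at_ends_beside e f sgn ->
    exists i, [/\ i \in ends e.2, i \in ends f.2 & p = pt i].
  move=> sgn2 sp.
  have sgn2R : zR R sgn ^+ 2 = 1 by rewrite -rmorphXn sgn2 rmorph1.
  have out := outside_arcP cdR pe pf sgn2R sp.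
  case/or3P => [out1|out2|/hasP[z ze /andP[zf sz]]].
  - have := out (pt e.2.1) (pt e.2.2).
    by rewrite !sqdist_zpt outside_arc_zpt ltNge oe => /(_ out1).
  - have := out (pt f.2.1) (pt f.2.2).
    by rewrite !sqdist_zpt outside_arc_zpt ltNge of_ => /(_ out2).
  exists z; split => //; apply: (circles_point_eq cdR pe pf).
  - by move: ze; rewrite !inE => /orP[] /eqP ->.
  - by move: zf; rewrite !inE => /orP[] /eqP ->.
  rewrite orient_zpt -[X in 0 <= X]mul1r -sgn2R expr2 mulrACA.
  by rewrite mulr_ge0// -rmorphM zR_ge0.
have [side|side] := lerP 0 (orient (zpt R e.1) (zpt R f.1) p).
  by apply: (beside 1) => //; rewrite rmorph1 mul1r.
apply: (beside (-1)) => //; by rewrite rmorphN rmorph1 mulN1r oppr_ge0 ltW.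
Qed.

Lemma links_rcons x s w : links (rcons (x :: s) w) = rcons (links (x :: s)) (last x s, w).
Proof.
rewrite /links /=; elim: s x => [|y s ih] x //=.
by rewrite ih.
Qed.

Lemma mem_links1 s l : l \in links s -> l.1 \in s.
Proof.
elim: s => [|x [|y s] ih]//; rewrite /links /= inE => /orP[/eqP ->|lin] /=.
  exact: mem_head.
by rewrite inE ih ?orbT.
Qed.

(** The list is peeled from its end: the turn from [u] through the last two vertices is what
    [arc_split] needs to cut off the last link. *)
Lemma links_cover c u v q p :
  {in u :: v :: q, forall w, sqdist (pt w) c = sqdist p c} ->
  path (fun w w' => 0 < orient (P u) (P w) (P w')) v q ->
  orient (pt u) (pt (last v q)) p <= 0 <->
  exists2 l, l \in links (u :: v :: q) & orient (pt l.1) (pt l.2) p <= 0.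
Proof.
elim/last_ind: q => [|q w ih] circ.
  move=> _ /=; split=> [le0|[l]]; first by exists (u, v); rewrite // /links mem_seq1.
  by rewrite /links mem_seq1 => /eqP ->.
rewrite rcons_path last_rcons => /andP[pathq turn].
have sub x : x \in u :: v :: q -> x \in u :: v :: rcons q w.
  by move=> xq; rewrite -[v :: _]rcons_cons -rcons_cons mem_rcons in_cons xq orbT.
have {}ih := ih (fun x xq => circ x (sub x xq)) pathq.
have lastq : last v q \in [:: u, v & rcons q w] by rewrite sub// in_cons mem_last orbT.
have wq : w \in [:: u, v & rcons q w] by rewrite -[v :: _]rcons_cons -rcons_cons mem_rcons mem_head.
have := arc_split (circ u (mem_head _ _)) (circ _ lastq) (circ _ wq).
rewrite orient_zpt zR_gt0 turn => /(_ isT) ->.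
rewrite -[v :: rcons _ _]rcons_cons -rcons_cons links_rcons [last u _]/=; split.
  case=> [/ih [l lq lp]|lp]; last first.
    by exists (last v q, w) => //; rewrite mem_rcons mem_head.
  by exists l => //; rewrite mem_rcons in_cons lq orbT.
case=> l; rewrite mem_rcons inE => /orP[/eqP -> /= ? |lq lp]; first by right.
by left; apply/ih; exists l.
Qed.

Lemma trail_cover tr : trail_ok tr -> all edge_ok (trail_edges tr) ->
  exists A : circular_arc R, forall p,
    arc_set A p <-> exists2 e, e \in trail_edges tr & edge_arc e p.
Proof.
case: tr => [[c cl] [|u [|v q]]]//=; rewrite /trail_ok /trail_edges /trail_links
  /trail_center /=.
move=> /and3P[/= /andP[/eqP vc /allP circ] open turns] eok.
have circR x : x \in u :: v :: q -> sqdist (pt x) (zpt R c) = sqdist (pt u) (zpt R c).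
  rewrite !inE => /or3P[/eqP ->//|/eqP ->|/circ /eqP e];
  by rewrite !sqdist_zpt ?vc ?e.
have cover p : sqdist p (zpt R c) = sqdist (pt u) (zpt R c) ->
    orient (pt u) (pt (last v q)) p <= 0 <->
    exists2 l, l \in links (u :: v :: q) & orient (pt l.1) (pt l.2) p <= 0.
  by move=> pc; apply: (@links_cover (zpt R c)) => // x /circR ->.
have path_mem : {subset (if cl then rcons [:: u, v & q] u else [:: u, v & q]) <=
    [:: u, v & q]}.
  by case: (cl) => // x; rewrite mem_rcons inE => /orP[/eqP ->|//]; exact: mem_head.
have circ1 l : l \in trail_links ((c, cl, [:: u, v & q]) : trail) ->
    sqdist (pt l.1) (zpt R c) = sqdist (pt u) (zpt R c).
  by move=> /mem_links1 /path_mem /circR.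
have arcsE p : (exists2 e, e \in [seq (c, l) | l <- trail_links ((c, cl, [:: u, v & q]) : trail)]
      & edge_arc e p) <-> sqdist p (zpt R c) = sqdist (pt u) (zpt R c) /\
    exists2 l, l \in trail_links ((c, cl, [:: u, v & q]) : trail) &
      orient (pt l.1) (pt l.2) p <= 0.
  split=> [[_ /mapP[l lin ->] [/= pc o]]|[pc [l lin o]]].
    by split; [rewrite pc circ1 | exists l].
  exists (c, l); first exact: map_f.
  by split => //=; rewrite pc circ1.
rewrite /trail_edges; case: cl path_mem circ1 arcsE eok => path_mem circ1 arcsE eok.
  have r0 : 0 < sqdist (pt u) (zpt R c).
    have : edge_ok (c, (u, v)) by apply: (allP eok); rewrite inE eqxx.
    by move=> /edge_okP[/= uv e]; apply: (sqdist_gt0 e); exact: nesym.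
  have [A AE] := @full_circle R (zpt R c) (Num.sqrt (sqdist (pt u) (zpt R c)))
    (ltac:(by rewrite sqrtr_gt0)).
  exists A => p; rewrite AE /= sqr_sqrtr ?(ltW r0)//; split.
    move=> pc; apply/arcsE; split => //.
    rewrite /trail_links /= -[v :: rcons _ _]rcons_cons -rcons_cons links_rcons [last u _]/=.
    (* A point off the arc from [u] to the last vertex lies on the complementary arc, which is the
       closing link. *)
    have [/(cover p pc) [l lin o]|o] := lerP (orient (pt u) (pt (last v q)) p) 0.
      by exists l => //; rewrite mem_rcons in_cons lin orbT.
    exists (last v q, u); first by rewrite mem_rcons mem_head.
    by rewrite /= orient_swap oppr_le0 ltW.
  by move=> /arcsE[].
have last_ne : pt u <> pt (last v q) by move/zpt_inj/esym/eqP; apply/negP.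
have [A [_ _ AE]] := circular_arc_between last_ne (circR (last v q)
  (ltac:(by rewrite in_cons mem_last orbT))).
exists A => p; rewrite AE; split; first by move=> [pc /(cover p pc) ?]; apply/arcsE.
by move=> /arcsE[pc l]; split => //; apply/cover.
Qed.

Lemma pairwise_mem (T : eqType) (r : rel T) (s : seq T) (x y : T) :
  pairwise r s -> x \in s -> y \in s -> x != y -> r x y || r y x.
Proof.
elim: s => //= z s ih /andP[/allP rz rs].
rewrite !in_cons => /predU1P[->|xs] /predU1P[->|ys]; rewrite ?eqxx// => ne.
- by rewrite rz.
- by rewrite rz ?orbT.
- exact: ih.
Qed.

Lemma same_endsC k l : same_ends k l = same_ends l k.
Proof.
rewrite /same_ends eq_sym; congr orb.
by case: k l => [a b] [c d]; apply/eqP/eqP => -[-> ->].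
Qed.

Lemma same_ends_trans k l m : same_ends k l -> same_ends k m -> same_ends l m.
Proof.
rewrite /same_ends; case: k l m => [a b] [c d] [e f] /=.
by move=> /orP[]/eqP[-> ->] /orP[]/eqP[-> ->]; rewrite !eqxx ?orbT.
Qed.

Lemma drawable_of_trails (G : sgraph) (verts : seq G) trs :
    uniq verts -> (forall u, u \in verts) -> size verts = n -> drawing_ok trs ->
    (forall u v : G, adj u v =
      has (same_ends (index u verts, index v verts)) (unzip2 (edges trs))) ->
  drawable_with R G (size trs).
Proof.
move=> uniq_verts all_verts size_verts /and4P[oks eoks avs pw] adjE.
pose code u := index u verts; pose pos u := pt (code u).
have code_lt u : (code u < n)%N by rewrite -size_verts index_mem.
have code_inj : injective code.
  by move=> u v; rewrite /code => e; rewrite -(nth_index u (all_verts u)) e nth_index.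
have pos_inj : injective pos.
  by move=> u v /pt_inj e; apply/code_inj/e.
have decode i : (i < n)%N -> exists u, code u = i.
  rewrite -size_verts => lt_i.
  have [x0 _] : exists x0, x0 \in verts.
    by case E: (verts) lt_i => [//|x0 s'] _; exists x0; rewrite mem_head.
  by exists (nth x0 verts i); rewrite /code index_uniq.
have eok e : e \in edges trs -> edge_ok e by move/(allP eoks).
have apart e f : e \in edges trs -> f \in edges trs -> e != f ->
    ~~ same_ends e.2 f.2 /\ (forall p, edge_arc e p -> edge_arc f p ->
      exists i, [/\ i \in ends e.2, i \in ends f.2 & p = pt i]).
  move=> ein fin ne; have /orP[/andP[ns meet]|/andP[ns meet]] := pairwise_mem pw ein fin ne.
    by split => // p; apply: meet_at_endsP => //; exact: eok.
  split => [|p pe pf]; first by rewrite same_endsC.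
  have [i [iF iE ->]] := meet_at_endsP (eok _ fin) (eok _ ein) ns meet pf pe.
  by exists i.
(* The arcs of [(u, v)] and [(v, u)] are chosen independently; this makes them come from the same
   listed edge. *)
have edge_unique e f : e \in edges trs -> f \in edges trs -> same_ends e.2 f.2 -> e = f.
  move=> ein fin ef; apply/eqP; apply/negPn/negP => ne.
  by case: (apart e f ein fin ne); rewrite ef.
have /choice[curve curveP] (uv : G * G) : exists A : circular_arc R, adj uv.1 uv.2 ->
    exists e, [/\ e \in edges trs, same_ends (code uv.1, code uv.2) e.2,
      arc_source A = pt e.2.1, arc_target A = pt e.2.2 & arc_set A = edge_arc e].
  have [uv_adj|] := boolP (adj uv.1 uv.2); last first.
    (* A nonadjacent pair receives an arbitrary circle, as the choice must be total. *)
    by have [A _] := full_circle (0 : R * R) ltr01; exists A.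
  move: uv_adj; rewrite adjE => /hasP[_ /mapP[e ein ->] ends_e].
  have [ne r] := edge_okP (eok e ein).
  have [A [? ? ?]] := circular_arc_between ne r.
  by exists A => _; exists e.
pose cv u v := curve (u, v).
have {}curveP u v : adj u v -> exists e, [/\ e \in edges trs,
    same_ends (code u, code v) e.2, arc_source (cv u v) = pt e.2.1,
    arc_target (cv u v) = pt e.2.2 & arc_set (cv u v) = edge_arc e].
  exact: (curveP (u, v)).
have edge_adj e : e \in edges trs -> exists u v, adj u v /\ arc_set (cv u v) = edge_arc e.
  move=> ein; case/and4P: (eok e ein) => /decode[u eu] /decode[v ev] _ _.
  have uv : adj u v.
    rewrite adjE; apply/hasP; exists e.2; first exact: map_f.
    by rewrite /same_ends -/(code u) -/(code v) eu ev -surjective_pairing eqxx.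
  exists u, v; split => //; have [f [fin uvf _ _ ->]] := curveP u v uv.
  congr edge_arc; apply: edge_unique => //.
  have -> : e.2 = (code u, code v) by rewrite eu ev -surjective_pairing.
  by rewrite same_endsC.
exists pos, cv; split.
  split => //.
  - move=> u v uv; have [e [ein ue _ _ ->]] := curveP u v uv.
    have vu : adj v u by rewrite adj_sym.
    have [f [fin vf _ _ ->]] := curveP v u vu.
    congr edge_arc; apply: edge_unique => //.
    apply: same_ends_trans ue _; rewrite same_endsC.
    by apply: same_ends_trans vf _; rewrite /same_ends eqxx orbT.
  - move=> u v uv; have [e [ein ue se te _]] := curveP u v uv.
    rewrite /connects se te /pos.
    by case/orP: ue => /eqP; case: (e.2) => a b [-> ->]; [left | right].
  - move=> u v w uv; have [e [ein ue _ _ ->]] := curveP u v uv.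
    have := allP (allP avs _ ein) (code w); rewrite mem_iota => /(_ (code_lt w)).
    move=> /avoidsP av /av; case/orP: ue => /eqP; case: (e.2) => a b [<- <-];
      rewrite !inE => /orP[]/eqP/code_inj; [left|right|right|left]; done.
  - move=> u v x y uv xy ne p.
    have [e [ein ue _ _ ->]] := curveP u v uv.
    have [f [fin xf _ _ ->]] := curveP x y xy.
    have [ef|/(apart e f ein fin)[_ meet]] := eqVneq e f.
      case/eqP: ne; rewrite -ef in xf.
      have : same_ends (code u, code v) (code x, code y).
        apply: (@same_ends_trans e.2); first by rewrite same_endsC.
        by rewrite same_endsC.
      by case/orP => /eqP[/code_inj -> /code_inj ->] //; exact: finset.setUC.
    move=> pe pf; have [i [iE iF ->]] := meet p pe pf.
    have [w wuv iw] : exists2 w, w \in [set u; v]%SET & i = code w.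
      move: iE; case/orP: ue => /eqP; case: (e.2) => a b [<- <-];
        rewrite !inE => /orP[]/eqP ->;
        [exists u | exists v | exists v | exists u]; by rewrite ?inE ?eqxx ?orbT.
    exists w; last by rewrite iw.
    rewrite finset.in_setI wuv /= inE; move: iF; rewrite iw.
    case/orP: xf => /eqP; case: (f.2) => a b [<- <-];
      by rewrite !inE !(inj_eq code_inj) // orbC.
have covers (i : 'I_(size trs)) : exists A : circular_arc R, forall p,
    arc_set A p <-> exists2 e, e \in trail_edges (nth (0, true, [::]) trs i) &
      edge_arc e p.
  have tr_in := mem_nth (0, true, [::]) (ltn_ord i).
  apply: trail_cover; first exact: (allP oks).
  apply/allP => e ein; apply: eok; apply/flattenP.
  by exists (trail_edges (nth (0, true, [::]) trs i)) => //; exact: map_f.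
have [A AE] := choice covers; exists A.
apply/seteqP; split => p.
  move=> [i _ /AE[e ein pe]].
  have [|u [v [uv uvE]]] := edge_adj e; last by exists u, v; rewrite uvE.
  apply/flattenP; exists (trail_edges (nth (0, true, [::]) trs i)) => //.
  by apply/map_f/mem_nth.
move=> [u [v [uv]]]; have [e [+ _ _ _ ->] pe] := curveP u v uv.
move=> /flattenP[_ /mapP[tr trin ->] ein].
have lt_i : (index tr trs < size trs)%N by rewrite index_mem.
exists (Ordinal lt_i) => //; apply/AE; exists e => //=.
by rewrite nth_index.
Qed.
End Checks.

(** * Skeletons over Z[sqrt 5] *)

(* The pair (a, b) of integers stands for a + b * sqrt 5. *)
Definition surd := (Z * Z)%type.
Definition surd_add (x y : surd) : surd := (x.1 + y.1, x.2 + y.2).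
Definition surd_sub (x y : surd) : surd := (x.1 - y.1, x.2 - y.2).
Definition surd_mul (x y : surd) : surd :=
  (x.1 * y.1 + 5 * (x.2 * y.2), x.1 * y.2 + x.2 * y.1).
Definition surd_gt0 (x : surd) : bool := pos_surd x.1 x.2 5.
Definition surd_ge0 (x : surd) : bool := (x == (0, 0)) || surd_gt0 x.

Definition svec := (surd * surd * surd)%type.
Definition svec_add (u v : svec) : svec :=
  (surd_add u.1.1 v.1.1, surd_add u.1.2 v.1.2, surd_add u.2 v.2).
Definition svec_sub (u v : svec) : svec :=
  (surd_sub u.1.1 v.1.1, surd_sub u.1.2 v.1.2, surd_sub u.2 v.2).
Definition svec_dot (u v : svec) : surd :=
  surd_add (surd_add (surd_mul u.1.1 v.1.1) (surd_mul u.1.2 v.1.2))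
    (surd_mul u.2 v.2).
Definition svec_det (u v w : svec) : surd :=
  surd_add (surd_add
    (surd_mul u.1.1 (surd_sub (surd_mul v.1.2 w.2) (surd_mul v.2 w.1.2)))
    (surd_mul u.1.2 (surd_sub (surd_mul v.2 w.1.1) (surd_mul v.1.1 w.2))))
    (surd_mul u.2 (surd_sub (surd_mul v.1.1 w.1.2) (surd_mul v.1.2 w.1.1))).

Section SkeletonCertificates.
Variables (table : seq svec) (lks : seq (nat * nat)).

Let S i := nth ((0, 0), (0, 0), (0, 0)) table i.
Let n := size table.

Definition linked i j := has (same_ends (i, j)) lks.

Definition supported i j : bool :=
  let l := svec_add (S i) (S j) in
  (svec_dot l (S j) == svec_dot l (S i)) &&
  all (fun k => [|| k == i, k == j
    | surd_gt0 (surd_sub (svec_dot l (S i)) (svec_dot l (S k)))]) (iota 0 n).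

(* By Cramer's rule, S j - S i is then a nonnegative combination of the
   S k - S i with k among a, b, c. *)
Definition in_cone i j a b c : bool :=
  let u := svec_sub (S a) (S i) in let v := svec_sub (S b) (S i) in
  let w := svec_sub (S c) (S i) in let x := svec_sub (S j) (S i) in
  let d := svec_det u v w in
  let coefs := [seq surd_mul d e | e <- [:: svec_det x v w; svec_det u x w; svec_det u v x]] in
  all surd_ge0 coefs && has surd_gt0 coefs.

Definition unsupported i j : bool :=
  let nbrs := [seq k <- iota 0 n | linked i k && (k != i) && (k != j)] in
  has (fun a => has (fun b => has (in_cone i j a b) nbrs) nbrs) nbrs.

Definition skeleton_ok : bool :=
  all (fun i => all (fun j =>
    if i == j then ~~ linked i j
    else if linked i j then supported i j else unsupported i j) (iota 0 n))
  (iota 0 n).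

Variable R : realType.

Definition surd_val (x : surd) : R := zR R x.1 + zR R x.2 * Num.sqrt 5.

Definition svec_val (v : svec) : 'rV[R]_3 :=
  vec3 (surd_val v.1.1) (surd_val v.1.2) (surd_val v.2).

Lemma surd_val_add x y : surd_val (surd_add x y) = surd_val x + surd_val y.
Proof. by rewrite /surd_val !zRD; ring. Qed.

Lemma surd_val_sub x y : surd_val (surd_sub x y) = surd_val x - surd_val y.
Proof. by rewrite /surd_val !zRB; ring. Qed.

Lemma surd_val_mul x y : surd_val (surd_mul x y) = surd_val x * surd_val y.
Proof.
have s5 : Num.sqrt 5 * Num.sqrt 5 = 5 :> R by rewrite -expr2 sqr_sqrtr.
have z5 : zR R 5%R = 5 by exact: (rmorph_nat (zR R)).
rewrite /surd_val !zRD !zRM z5 -[X in X * (_ * zR R y.2)]s5; ring.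
Qed.

Definition surd_valE := (surd_val_add, surd_val_sub, surd_val_mul).

Lemma surd_gt0P x : surd_gt0 x -> 0 < surd_val x.
Proof.
have z5 : zR R 5%R = 5 by exact: (rmorph_nat (zR R)).
rewrite /surd_gt0 -(pos_surd_zR R) => /pos_surdP; apply; first exact: sqrtr_ge0.
by rewrite sqr_sqrtr.
Qed.

Lemma surd_ge0P x : surd_ge0 x -> 0 <= surd_val x.
Proof.
case/orP => [/eqP ->|/surd_gt0P/ltW//].
by rewrite /surd_val rmorph0 mul0r addr0.
Qed.

Lemma dot3E (l : 'rV[R]_3) (v : svec) : dot3 l (svec_val v) =
  l 0 0 * surd_val v.1.1 + l 0 1 * surd_val v.1.2 + l 0 2%R * surd_val v.2.
Proof.
rewrite /dot3 !big_ord_recl big_ord0 addr0 !mxE /= addrA.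
by congr (_ * _ + l _ _ * _ + l _ _ * _); apply: val_inj.
Qed.

Lemma dot3_svec u v : dot3 (svec_val u) (svec_val v) = surd_val (svec_dot u v).
Proof. by rewrite dot3E !mxE /= /svec_dot !surd_valE. Qed.

Lemma cramer_dot3 (l : 'rV[R]_3) (u v w x : svec) :
  surd_val (svec_det u v w) * dot3 l (svec_val x) =
  surd_val (svec_det x v w) * dot3 l (svec_val u) +
  surd_val (svec_det u x w) * dot3 l (svec_val v) +
  surd_val (svec_det u v x) * dot3 l (svec_val w).
Proof. by rewrite !dot3E /svec_det !surd_valE; ring. Qed.

Lemma dot3_sub (l : 'rV[R]_3) u v :
  dot3 l (svec_val (svec_sub u v)) = dot3 l (svec_val u) - dot3 l (svec_val v).
Proof. by rewrite !dot3E /= !surd_valE; ring. Qed.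

(** Were the two values equal, [l] would vanish on [S j - S i], whereas Cramer's identity times the
    determinant writes this zero as a combination of negative numbers with nonnegative coefficients,
    one of them positive. Multiplying by the determinant instead of dividing stays in the ring and
    allows either sign. *)
Lemma in_cone_lt (l : 'rV[R]_3) i j a b c : in_cone i j a b c ->
  {in [:: a; b; c], forall k, dot3 l (svec_val (S k)) < dot3 l (svec_val (S i))} ->
  dot3 l (svec_val (S j)) != dot3 l (svec_val (S i)).
Proof.
rewrite /in_cone; set u := svec_sub (S a) _; set v := svec_sub (S b) _.
set w := svec_sub (S c) _; set x := svec_sub (S j) _.
move=> cone lt_i; apply/eqP => eq_ij.
have /= := congr1 ( *%R (surd_val (svec_det u v w))) (cramer_dot3 l u v w x).
have -> : dot3 l (svec_val x) = 0 by rewrite dot3_sub eq_ij subrr.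
have neg k : k \in [:: a; b; c] -> dot3 l (svec_val (svec_sub (S k) (S i))) < 0.
  by move=> kin; rewrite dot3_sub subr_lt0 lt_i.
have nu : dot3 l (svec_val u) < 0 by apply: neg; rewrite !inE eqxx.
have nv : dot3 l (svec_val v) < 0 by apply: neg; rewrite !inE eqxx orbT.
have nw : dot3 l (svec_val w) < 0 by apply: neg; rewrite !inE eqxx !orbT.
rewrite !mulr0 !mulrDr !mulrA -!surd_val_mul.
case/andP: cone => /= /and4P[/surd_ge0P g1 /surd_ge0P g2 /surd_ge0P g3 _].
have [p1 p2 p3] := And3 (mulr_ge0_le0 g1 (ltW nu)) (mulr_ge0_le0 g2 (ltW nv))
  (mulr_ge0_le0 g3 (ltW nw)).
case/or4P => // /surd_gt0P g.
- by have := pmulr_rlt0 (dot3 l (svec_val u)) g; rewrite nu => *; lra.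
- by have := pmulr_rlt0 (dot3 l (svec_val v)) g; rewrite nv => *; lra.
- by have := pmulr_rlt0 (dot3 l (svec_val w)) g; rewrite nw => *; lra.
Qed.

(** The factor 2 clears the denominators of [golden] and its inverse. For a non-edge, a half-space
    touching exactly at [u] and [v] would be strict at the chosen neighbours of [u], which
    [in_cone_lt] forbids. *)
Lemma skeleton_adjE (V : finType) (P : V -> 'rV[R]_3) (verts : seq V) :
    uniq verts -> (forall v, v \in verts) -> size verts = n ->
    (forall v, 2 *: P v = svec_val (S (index v verts))) -> skeleton_ok ->
  forall u v, skeleton_adj P u v = linked (index u verts) (index v verts).
Proof.
move=> uniq_verts all_verts size_verts PE /allP ok u v.
pose code w := index w verts.
have code_in w : code w \in iota 0 n by rewrite mem_iota -size_verts index_mem all_verts.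
have code_inj : injective code.
  by move=> x y; rewrite /code => e; rewrite -(nth_index x (all_verts x)) e nth_index.
have {ok} := allP (ok (code u) (code_in u)) (code v) (code_in v).
have dotP (l : 'rV[R]_3) w : 2 * dot3 l (P w) = dot3 l (svec_val (S (code w))).
  rewrite -PE /dot3 mulr_sumr; apply: eq_bigr => i _.
  by rewrite mxE mulrCA.
rewrite /skeleton_adj -!/(code _) (inj_eq code_inj).
case: eqVneq => [->|uv] /=; first by move/negbTE.
case: ifP => _ ok.
  apply/asboolP; move: ok; rewrite /supported.
  set l := svec_add _ _ => /andP[/eqP dot_v /allP lt_w].
  exists (svec_val l), (surd_val (svec_dot l (S (code u))) / 2) => w.
  have := lt_w (code w) (code_in w); rewrite !(inj_eq code_inj).
  have -> : dot3 (svec_val l) (P w) = surd_val (svec_dot l (S (code w))) / 2.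
    by rewrite -dot3_svec -dotP; lra.
  case: eqVneq => [->|wu] /=; first by split=> //; split; [left|].
  case: eqVneq => [->|wv] /=; first by rewrite dot_v; split=> //; split; [right|].
  move=> /surd_gt0P; rewrite surd_val_sub subr_gt0 => lt_u.
  have half_lt : surd_val (svec_dot l (S (code w))) / 2 <
      surd_val (svec_dot l (S (code u))) / 2 by rewrite ltr_pM2r// invr_gt0.
  split; first exact: ltW.
  split=> [e|[] e]; first by rewrite e ltxx in half_lt.
    by rewrite e eqxx in wu.
  by rewrite e eqxx in wv.
apply/asboolP => -[l [c supp]].
have eq_c w : w = u \/ w = v -> dot3 l (svec_val (S (code w))) = 2 * c.
  by move=> wuv; rewrite -dotP; congr (2 * _); apply/(supp w).2.
have lt_c k : k \in [seq k <- iota 0 n | linked (code u) k && (k != code u) && (k != code v)] ->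
    dot3 l (svec_val (S k)) < dot3 l (svec_val (S (code u))).
  rewrite mem_filter mem_iota -size_verts /= => /andP[/andP[/andP[_ ku] kv] lt_k].
  have kE : code (nth u verts k) = k by rewrite /code index_uniq.
  rewrite eq_c; last by left.
  rewrite -kE -dotP ltr_pM2l// lt_neqAle (supp _).1 andbT.
  by apply/eqP => /(supp _).2 [] e; move: kE; rewrite e => /esym/eqP; apply/negP.
move: ok => /hasP[a ain /hasP[b bin /hasP[d din cone]]].
have lt3 : {in [:: a; b; d], forall k,
    dot3 l (svec_val (S k)) < dot3 l (svec_val (S (code u)))}.
  by move=> k; rewrite !inE => /or3P[]/eqP ->; exact: lt_c.
have := in_cone_lt cone lt3.
by rewrite (eq_c v (or_intror erefl)) (eq_c u (or_introl erefl)) eqxx.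
Qed.
End SkeletonCertificates.

(** * The five drawings *)

Lemma is_arc_number_le (R : realType) (G : sgraph) (n : nat) :
  drawable_with R G n -> exists2 k, is_arc_number R G k & (k <= n)%N.
Proof.
move=> Gn; have ex_k : exists k, `[< drawable_with R G k >] by exists n; apply/asboolP.
exists (ex_minn ex_k); case: ex_minnP => k /asboolP Gk k_min; last first.
  by apply: k_min; apply/asboolP.
by split=> // j Gj; apply: k_min; apply/asboolP.
Qed.

(** All finite tests form one closed boolean, settled by a single computation for each solid;
    position in [verts] numbers the vertices in both the drawing and the table. *)
Lemma drawable_skeleton (R : realType) (V : finType) (P : V -> 'rV[R]_3)
    (S : V -> svec) (verts : seq V) (coords : seq (Z * Z)) (trs : seq trail) :
    (forall v, 2 *: P v = svec_val R (S v)) -> (forall v, v \in verts) ->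
    [&& uniq verts, uniq coords, size verts == size coords,
        drawing_ok coords trs & skeleton_ok (map S verts) (unzip2 (edges trs))] ->
  drawable_with R (skeleton P) (size trs).
Proof.
move=> PE all_verts /and5P[uniq_verts uniq_coords /eqP size_verts ok adj_ok].
apply: (drawable_of_trails R uniq_coords (G := skeleton P) uniq_verts) => //.
apply: (skeleton_adjE uniq_verts all_verts _ _ adj_ok) => [|v]; first by rewrite size_map.
by rewrite (nth_map v) ?index_mem// nth_index.
Qed.

Section IntegerModels.
Variable R : realType.

Definition zsg (b : bool) : Z := if b then -1 else 1.

Definition surd_scale (z : Z) (x : surd) : surd := (z * x.1, z * x.2).

Definition scyc (i : 'I_3) (x y z : surd) : svec :=
  let s := [:: x; y; z] in
  (nth (0, 0) s (i %% 3), nth (0, 0) s ((i + 1) %% 3), nth (0, 0) s ((i + 2) %% 3)).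

Lemma zR_zsg b : zR R (zsg b) = sg R b.
Proof. by case: b; rewrite /sg /zsg ?rmorphN rmorph1. Qed.

Lemma surd_val_scale z x : surd_val R (surd_scale z x) = zR R z * surd_val R x.
Proof. by rewrite /surd_val !zRM; ring. Qed.

Lemma surd_val_int z : surd_val R (z, 0) = zR R z.
Proof. by rewrite /surd_val rmorph0 mul0r addr0. Qed.

Lemma svec_val_scyc i x y z (x' y' z' : R) :
  surd_val R x = 2 * x' -> surd_val R y = 2 * y' -> surd_val R z = 2 * z' ->
  2 *: cyc3 i x' y' z' = svec_val R (scyc i x y z).
Proof.
move=> ex ey ez; apply/rowP => j; rewrite !mxE.
by case: i => -[|[|[|]]]//= ?; case: j => -[|[|[|]]]//= ?; rewrite ?ex ?ey ?ez.
Qed.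

Lemma svec_val_vec3 x y z (x' y' z' : R) :
  surd_val R x = 2 * x' -> surd_val R y = 2 * y' -> surd_val R z = 2 * z' ->
  2 *: vec3 x' y' z' = svec_val R (x, y, z).
Proof.
move=> ex ey ez; apply/rowP => j; rewrite !mxE /=.
by case: j => -[|[|[|]]]//= ?; rewrite ?ex ?ey ?ez.
Qed.

Lemma surd_val_sg b : surd_val R (2 * zsg b, 0) = 2 * sg R b.
Proof. by rewrite surd_val_int zRM zR_zsg (rmorph_nat (zR R)). Qed.

Lemma surd_val_golden : surd_val R (1, 1) = 2 * golden R.
Proof. by rewrite /surd_val rmorph1 /golden; lra. Qed.

Lemma surd_val_golden_inv : surd_val R (-1, 1) = 2 / golden R.
Proof.
have s5 : Num.sqrt 5 ^+ 2 = 5 :> R by rewrite sqr_sqrtr.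
have g0 : golden R != 0.
  by rewrite gt_eqF// divr_gt0// ltr_pwDl// sqrtr_ge0.
apply: (mulIf g0); rewrite divfK// /surd_val rmorphN rmorph1 /golden.
have -> : (- 1 + 1 * Num.sqrt 5) * ((1 + Num.sqrt 5) / 2) =
    (Num.sqrt 5 ^+ 2 - 1) / 2 :> R by field.
by rewrite s5; lra.
Qed.
End IntegerModels.

(** One face becomes a full circle of radius 5; the fourth vertex is the midpoint of a semicircle
    between two of its vertices, and one more arc joins it to the third. *)
Lemma drawable_tetrahedron (R : realType) : drawable_with R (tetrahedron R) 3.
Proof.
apply: (@drawable_skeleton R _ _
  (fun v : bool * bool => ((2 * zsg v.1, 0), (2 * zsg v.2, 0), (2 * (zsg v.1 * zsg v.2), 0)))
  [:: (false, false); (true, false); (false, true); (true, true)]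
  [:: (-4, -3); (4, -3); (0, 5); (0, 1)]
  [:: ((0, 0), true, [:: 0; 1; 2]%N);
      ((0, -3), false, [:: 1; 3; 0]%N);
      ((2, 3), false, [:: 2; 3]%N)]).
- move=> v; apply: svec_val_vec3; rewrite ?surd_val_sg//.
  by rewrite surd_val_int !zRM !zR_zsg (rmorph_nat (zR R)).
- by case=> [[] []].
- by vm_compute.
Qed.

Definition ord3_0 : 'I_3 := @Ordinal 3 0 isT.
Definition ord3_1 : 'I_3 := @Ordinal 3 1 isT.
Definition ord3_2 : 'I_3 := @Ordinal 3 2 isT.

(** Three circles crossing pairwise: opposite vertices are the common points of two circles, and
    each circle is an equatorial 4-cycle. *)
Lemma drawable_octahedron (R : realType) : drawable_with R (octahedron R) 3.
Proof.
apply: (@drawable_skeleton R _ _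
  (fun v : 'I_3 * bool => scyc v.1 (2 * zsg v.2, 0) (0, 0) (0, 0))
  [:: (ord3_0, false); (ord3_0, true); (ord3_1, false); (ord3_1, true);
      (ord3_2, false); (ord3_2, true)]
  [:: (3, 4); (3, -4); (0, 5); (5, 0); (6, 5); (1, 0)]
  [:: ((0, 0), true, [:: 1; 3; 0; 2]%N);
      ((6, 0), true, [:: 1; 4; 0; 5]%N);
      ((3, 3), true, [:: 5; 3; 4; 2]%N)]).
- by move=> v; apply: svec_val_scyc; rewrite ?surd_val_sg ?surd_val_int ?rmorph0 ?mulr0.
- by case=> [[[|[|[|]]] ?] []].
- by vm_compute.
Qed.

(** Two nested squares, invariant under a quarter turn: each arc takes an outer edge, a spoke and an
    inner edge. The radius is 5, with offsets (3, 4) from the centres up to order and signs. *)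
Lemma drawable_cube (R : realType) : drawable_with R (cube R) 4.
Proof.
apply: (@drawable_skeleton R _ _
  (fun v : bool * bool * bool =>
    ((2 * zsg v.1.1, 0), (2 * zsg v.1.2, 0), (2 * zsg v.2, 0)))
  [:: (false, false, false); (true, false, false);
      (true, true, false); (false, true, false);
      (false, false, true); (true, false, true);
      (true, true, true); (false, true, true)]
  [:: (7, 0); (0, 7); (-7, 0); (0, -7); (0, 1); (-1, 0); (0, -1); (1, 0)]
  [:: ((3, 3), false, [:: 0; 1; 5; 6]%N);
      ((-3, 3), false, [:: 1; 2; 6; 7]%N);
      ((-3, -3), false, [:: 2; 3; 7; 4]%N);
      ((3, -3), false, [:: 3; 0; 4; 5]%N)]).
- by move=> v; apply: svec_val_vec3; rewrite surd_val_sg.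
- by case=> [[[] []] []].
- by vm_compute.
Qed.

(* The drawing of the cube with vertices 0..7 and covering arcs of radius 25,
   where each edge is subdivided by one of the vertices 8..19 and each face is
   halved by a single edge. *)
Lemma drawable_dodecahedron (R : realType) : drawable_with R (dodecahedron R) 10.
Proof.
apply: (@drawable_skeleton R _ _
  (fun v : (bool * bool * bool) + ('I_3 * bool * bool) =>
    match v with
    | inl (a, b, c) => ((2 * zsg a, 0), (2 * zsg b, 0), (2 * zsg c, 0))
    | inr (i, a, b) =>
        scyc i (0, 0) (surd_scale (zsg a) (-1, 1)) (surd_scale (zsg b) (1, 1))
    end)
  (* The [inl] vertices form an inscribed cube, each edge of which is a diagonal of one pentagon and
     is replaced by the path through the vertex that it cuts off. *)
  [:: inl (false, false, false); inl (true, false, false);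
      inl (true, true, false); inl (false, true, false);
      inl (false, false, true); inl (true, false, true);
      inl (true, true, true); inl (false, true, true);
      inr (ord3_0, false, false); inr (ord3_2, false, true);
      inr (ord3_0, true, false); inr (ord3_2, false, false);
      inr (ord3_1, false, false); inr (ord3_1, true, false);
      inr (ord3_1, true, true); inr (ord3_1, false, true);
      inr (ord3_0, false, true); inr (ord3_2, true, true);
      inr (ord3_0, true, true); inr (ord3_2, true, false)]
  (* Offsets from the centres of the four long arcs are (7, 24) or (15, 20) up to order and signs,
     the two ways to write 625 as a sum of two nonzero squares. *)
  [:: (31, 0); (0, 31); (-31, 0); (0, -31); (0, 17); (-17, 0); (0, -17); (17, 0);
      (27, 22); (-22, 27); (-27, -22); (22, -27);
      (22, 13); (-13, 22); (-22, -13); (13, -22);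
      (-8, 13); (-13, -8); (8, -13); (13, 8)]
  [:: ((7, 7), false, [:: 0; 8; 1; 13; 5; 17; 6]%N);
      ((-7, 7), false, [:: 1; 9; 2; 14; 6; 18; 7]%N);
      ((-7, -7), false, [:: 2; 10; 3; 15; 7; 19; 4]%N);
      ((7, -7), false, [:: 3; 11; 0; 12; 4; 16; 5]%N);
      ((-22, 27), false, [:: 8; 10]%N); ((-13, -8), false, [:: 18; 16]%N);
      ((0, 0), false, [:: 12; 13]%N); ((0, 0), false, [:: 14; 15]%N);
      ((0, -14), false, [:: 11; 19]%N); ((0, 14), false, [:: 9; 17]%N)]).
- case=> [[[a b] c]|[[i a] b]].
    by apply: svec_val_vec3; rewrite surd_val_sg.
  apply: svec_val_scyc; first by rewrite surd_val_int rmorph0 mulr0.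
    by rewrite surd_val_scale zR_zsg surd_val_golden_inv mulrCA.
  by rewrite surd_val_scale zR_zsg surd_val_golden mulrCA.
- by case=> [[[[] []] []]|[[[[|[|[|]]] ?] []] []]].
- by vm_compute.
Qed.

(* The vertices are the stereographic image of an antipodal configuration on
   the quadric q = 1, where q is the quadratic form making (1, 1, 1),
   (1, 1, -1), (-1, 1, 1), (1, -1, -7/5), (2, 1, -1) and (-1, -3, -1) unit
   vectors: six of the seven covering circles come from the planes x = 1,
   x = -1, y = 1, y = -1, z = 1, z = -1, the seventh one from a plane through
   the origin. *)
Lemma drawable_icosahedron (R : realType) : drawable_with R (icosahedron R) 7.
Proof.
apply: (@drawable_skeleton R _ _
  (fun v : 'I_3 * bool * bool =>
    scyc v.1.1 (0, 0) (2 * zsg v.1.2, 0) (surd_scale (zsg v.2) (1, 1)))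
  [:: (ord3_0, false, false); (ord3_0, false, true);
      (ord3_0, true, false); (ord3_0, true, true);
      (ord3_1, false, false); (ord3_1, false, true);
      (ord3_1, true, false); (ord3_1, true, true);
      (ord3_2, false, false); (ord3_2, false, true);
      (ord3_2, true, false); (ord3_2, true, true)]
  [:: (-30, 20); (2, -16); (-22, 32); (8, -14); (-28, -16); (42, 24);
      (-14, -8); (14, 8); (-58, 4); (-8, 14); (2, -36); (6, -4)]
  (* The closed trail is a hexagon made of three antipodal pairs. Each open trail runs through the
     five neighbours of one of its vertices and omits one edge of that pentagon; the six omitted
     edges form a perfect matching. *)
  [:: ((7, 4), false, [:: 0; 4; 10; 5; 2]%N);
      ((0, 0), false, [:: 3; 7; 9; 6; 1]%N);
      ((-13, 39), false, [:: 4; 1; 3; 5; 8]%N);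
      ((52, -26), false, [:: 5; 7; 11; 1; 10]%N);
      ((-33, 9), false, [:: 9; 2; 8; 4; 6]%N);
      ((-8, 14), false, [:: 7; 2; 0; 6; 11]%N);
      ((-28, -16), true, [:: 8; 10; 3; 11; 9; 0]%N)]).
- move=> v; apply: svec_val_scyc; first by rewrite surd_val_int rmorph0 mulr0.
    by rewrite surd_val_sg.
  by rewrite surd_val_scale zR_zsg surd_val_golden mulrCA.
- by case=> [[[[|[|[|]]] ?] []] []].
- by vm_compute.
Qed.

Theorem proposition8 (R : realType) :
  [/\ exists2 k : nat, is_arc_number R (tetrahedron R) k & (k <= 3)%N,
      exists2 k : nat, is_arc_number R (octahedron R) k & (k <= 3)%N,
      exists2 k : nat, is_arc_number R (cube R) k & (k <= 4)%N,
      exists2 k : nat, is_arc_number R (dodecahedron R) k & (k <= 10)%N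
    & exists2 k : nat, is_arc_number R (icosahedron R) k & (k <= 7)%N].
Proof.
split; apply: is_arc_number_le.
- exact: drawable_tetrahedron.
- exact: drawable_octahedron.
- exact: drawable_cube.
- exact: drawable_dodecahedron.
- exact: drawable_icosahedron.
Qed.
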